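(* Let $\boldsymbol{\tilde A}$ be an $m\times n$ fuzzy matrix all of whose entries lie in $V=\{\langle a;e^a,e^a,a,a\rangle: a\in\mathbb{R}\}\subset\mathcal{X}$. Then there exists a crisp (real) matrix $A\in\mathbb{R}^{m\times n}$ such that, for every $\boldsymbol{\tilde b}\in\mathcal{X}^m$, the systems $A\boldsymbol{\tilde x}=\boldsymbol{\tilde b}$ and $\boldsymbol{\tilde A}\boldsymbol{\tilde x}=\boldsymbol{\tilde b}$ have the same solution set in $\mathcal{X}^n$.
   Context: Gaussian-PDMF space $\mathcal{X}$: the set of functions $f:\mathbb{R}\to[0,1]$ with parameters $x\in\mathbb{R}$, $d^-,d^+>0$, $\mu^-,\mu^+\in\mathbb{R}$, given by $f(x)=1$, $f(\tau)=0$ for $\tau\le x-d^-$ or $\tau\ge x+d^+$, $f(\tau)=\int_{-\infty}^{\tan(\frac{\pi}{d^-}(\tau-x+d^-)-\frac{\pi}{2})}\frac{1}{\sqrt{2\pi}}e^{-\frac12(t-\mu^-)^2}dt$ for $\tau\in(x-d^-,x)$, and $f(\tau)=\int_{-\infty}^{\tan(\frac{\pi}{d^+}(x+d^+-\tau)-\frac{\pi}{2})}\frac{1}{\sqrt{2\pi}}e^{-\frac12(t-\mu^+)^2}dt$ for $\tau\in(x,x+d^+)$. Such an element is identified with its parameter tuple, written $\tilde x=\langle x;d^-,d^+,\mu^-,\mu^+\rangle$; two elements are equal iff all five parameters coincide. Operations on $\mathcal{X}$, for $\tilde x_i=\langle x_i;d_i^-,d_i^+,\mu_i^-,\mu_i^+\rangle$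 and $\lambda\in\mathbb{R}$: $\tilde x_1+\tilde x_2=\langle x_1+x_2;d_1^-d_2^-,d_1^+d_2^+,\mu_1^-+\mu_2^-,\mu_1^++\mu_2^+\rangle$; $\lambda\tilde x=\langle\lambda x;(d^-)^\lambda,(d^+)^\lambda,\lambda\mu^-,\lambda\mu^+\rangle$; $\tilde x_1\tilde x_2=\langle x_1x_2;(d_1^-)^{\ln d_2^-},(d_1^+)^{\ln d_2^+},\mu_1^-\mu_2^-,\mu_1^+\mu_2^+\rangle$. With these operations $\mathcal{X}$ is a real vector space and a commutative ring with identity $\tilde1=\langle1;e,e,1,1\rangle$ ($e$ is Euler's number). For a real matrix $A=(a_{ij})\in\mathbb{R}^{m\times n}$ and $\boldsymbol{\tilde x}=(\tilde x_1,\dots,\tilde x_n)^T\in\mathcal{X}^n$, $A\boldsymbol{\tilde x}\in\mathcal{X}^m$ has $i$-th entry $\sum_{k=1}^na_{ik}\tilde x_k$ (real scalar multiplication). For a fuzzy matrix $\boldsymbol{\tilde A}=(\tilde a_{ij})\in\mathcal{X}^{m\times n}$, $\boldsymbol{\tilde A}\boldsymbol{\tilde x}\in\mathcal{X}^m$ has $i$-th entry $\sum_{k=1}^n\tilde a_{ik}\tilde x_k$ (ring multiplication). *)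

(* Defs.v *)
From HB Require Import structures.
From mathcomp Require Import all_boot all_order all_algebra.
From mathcomp Require Import all_classical all_reals all_analysis.
From mathcomp Require Import ring lra.

Set Implicit Arguments.
Unset Strict Implicit.
Unset Printing Implicit Defensive.

Import Order.TTheory GRing.Theory Num.Theory.
Import numFieldNormedType.Exports.
Local Open Scope classical_set_scope.
Local Open Scope ring_scope.

(* The tuple <core; dl, dr, ml, mr> stands for <x; d^-, d^+, mu^-, mu^+>. *)
Record gpdmf (R : realType) := Gpdmf {
  core : R; dl : R; dr : R; ml : R; mr : R;
  dl_gt0 : 0 < dl; dr_gt0 : 0 < dr }.
Arguments Gpdmf {R} core {dl dr} ml mr dl_gt0 dr_gt0.

(* [normal_pdf mu 1] is the density t |-> exp(-(t - mu)^2 / 2) / sqrt(2 pi). *)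
Definition gauss_cdf (R : realType) (mu z : R) : R :=
  \int[lebesgue_measure]_(t in `]-oo, z]) normal_pdf mu 1 t.

(* Elements of the space are functions R -> [0, 1] (lemma [pdmf_itv]); passing
   to parameter tuples is legitimate by [pdmf_inj]. *)
Definition pdmf (R : realType) (p : gpdmf R) (tau : R) : R :=
  if tau == core p then 1
  else if (tau <= core p - dl p) || (core p + dr p <= tau) then 0
  else if tau < core p then
    gauss_cdf (ml p) (tan (pi / dl p * (tau - core p + dl p) - pi / 2))
  else
    gauss_cdf (mr p) (tan (pi / dr p * (core p + dr p - tau) - pi / 2)).

Section gauss_cdf_theory.
Context {R : realType}.
Implicit Types mu z : R.
Local Notation leb := (@lebesgue_measure R).

Let integrable_pdf mu (D : set R) : measurable D ->
  leb.-integrable D (fun x => (normal_pdf mu 1 x)%:E).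
Proof.
move=> mD; by apply: (integrableS measurableT) => //; exact: integrable_normal_pdf.
Qed.

Let integral_pos z (i : interval R) (f : R -> R) :
  leb [set` i] = +oo%E ->
  leb.-integrable [set` i] (fun x => (f x)%:E) ->
  (forall x, x \in i -> 0 < f x) ->
  0 < \int[leb]_(t in [set` i]) f t.
Proof.
move=> mi intf f0.
rewrite lt_neqAle; apply/andP; split; last first.
  by apply: Rintegral_ge0 => // x ix; exact/ltW/f0.
apply/negP => /eqP /esym f_eq0.
have : (\int[leb]_(x in [set` i]) `|(f x)%:E| = 0)%E.
  have -> : (\int[leb]_(x in [set` i]) `|(f x)%:E| =
             \int[leb]_(x in [set` i]) (f x)%:E)%E.
    by apply: eq_integral => x; rewrite inE => /= xi; rewrite gtr0_norm// f0.
  rewrite -[LHS]fineK; first by rewrite [fine _]f_eq0.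
  exact: integrable_fin_num.
move/(ae_eq_integral_abs leb (measurable_itv i)
        (measurable_int _ intf)).1 => ae0.
case: ae0 => N [mN N0 sub].
have : (leb [set` i] <= leb N)%E.
  apply: le_measure; rewrite ?inE//; apply: subset_trans sub => x xi /= h.
  by have := h xi; case=> fx0; have := f0 _ xi; rewrite fx0 ltxx.
by rewrite mi N0 leye_eq.
Qed.

Lemma gauss_cdf_gt0 mu z : 0 < gauss_cdf mu z.
Proof.
apply: integral_pos => //; first by rewrite lebesgue_measure_itv/= ?ltNyr ?ltry.
  exact: integrable_pdf.
move=> x _; rewrite normal_pdfE ?oner_neq0//.
by rewrite mulr_gt0 ?normal_peak_gt0 ?oner_neq0 ?expR_gt0.
Qed.

Lemma gauss_cdf_lt1 mu z : gauss_cdf mu z < 1.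
Proof.
have pos : 0 < \int[leb]_(t in `]z, +oo[) normal_pdf mu 1 t.
  apply: integral_pos => //; first by rewrite lebesgue_measure_itv/= ?ltNyr ?ltry.
    exact: integrable_pdf.
  move=> x _; rewrite normal_pdfE ?oner_neq0//.
  by rewrite mulr_gt0 ?normal_peak_gt0 ?oner_neq0 ?expR_gt0.
have : \int[leb]_(t in setT) normal_pdf mu 1 t = 1.
  by rewrite /Rintegral integral_normal_pdf.
have eT : [set: R] = `]-oo, z] `|` `]z, +oo[.
  by apply/seteqP; split=> x //= _; rewrite !in_itv/= andbT; apply/orP;
    case: leP.
rewrite eT Rintegral_setU//.
- by move=> <-; rewrite ltrDl.
- by apply: integrable_pdf; exact: measurableU.
- apply/disj_setPRL => x /=; rewrite !in_itv/= andbT => zx.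
  by apply/negP; rewrite -ltNge.
Qed.

Lemma gauss_cdf_sep mu1 mu2 : mu1 < mu2 ->
  gauss_cdf mu2 mu1 < gauss_cdf mu1 mu1.
Proof.
move=> lt12; rewrite -subr_gt0 /gauss_cdf -RintegralB//;
  [|exact: integrable_pdf..].
apply: integral_pos => //; first by rewrite lebesgue_measure_itv/= ?ltNyr ?ltry.
  set D := [set` _]; have mD : measurable D by exact: measurable_itv.
  exact: (integrableB _ (integrable_pdf mu1 mD) (integrable_pdf mu2 mD)).
move=> x; rewrite in_itv/= => xz; rewrite subr_gt0 !normal_pdfE ?oner_neq0//.
rewrite ltr_pM2l ?normal_peak_gt0 ?oner_neq0// /normal_fun ltr_expR.
rewrite ltr_pM2r ?invr_gt0 ?mulrn_wgt0 ?exprn_gt0// ltrN2.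
rewrite -subr_gt0.
rewrite (_ : _ - _ = (mu2 - mu1) * (mu1 + mu2 - x *+ 2)); last by ring.
by rewrite mulr_gt0//; lra.
Qed.

Lemma gauss_cdf_inj mu1 mu2 : gauss_cdf mu1 =1 gauss_cdf mu2 -> mu1 = mu2.
Proof.
move=> e; have [/gauss_cdf_sep|/gauss_cdf_sep|//] := ltgtP mu1 mu2;
  by rewrite e ltxx.
Qed.

End gauss_cdf_theory.

Section pdmf_theory.
Context {R : realType}.
Implicit Types (p q : gpdmf R) (tau z : R).

Lemma pdmf_itv p tau : 0 <= pdmf p tau <= 1.
Proof.
have cdf01 mu z : 0 <= gauss_cdf mu z <= 1.
  by rewrite (ltW (gauss_cdf_gt0 _ _)) (ltW (gauss_cdf_lt1 _ _)).
rewrite /pdmf; case: ifP => _; first by rewrite ler01 lexx.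
by case: ifP => _; [rewrite lexx ler01|case: ifP].
Qed.

Lemma pdmf_eq1 p tau : (pdmf p tau == 1) = (tau == core p).
Proof.
rewrite /pdmf; case: ifP => // _; first by rewrite eqxx.
case: ifP => _; first by rewrite eq_sym oner_eq0.
by case: ifP => _; rewrite (lt_eqF (gauss_cdf_lt1 _ _)).
Qed.

Lemma pdmf_gt0 p tau :
  (0 < pdmf p tau) = (core p - dl p < tau) && (tau < core p + dr p).
Proof.
rewrite /pdmf; have [->|_] := eqVneq.
  by rewrite ltr01 ltrBlDr !ltrDl dl_gt0 dr_gt0.
case: ifP => [|/negbT].
  by rewrite ltxx => /orP[]h; apply/esym/negbTE; rewrite negb_and -!leNgt h ?orbT.
rewrite negb_or -!ltNge => -> .
by case: ifP => _; exact: gauss_cdf_gt0.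
Qed.

Let scaled_atan z : 0 < (atan z / pi + 1 / 2 : R) < 1.
Proof.
have [lo hi] : - (pi / 2) < atan z /\ atan z < pi / 2.
  by split; [exact: atan_gtNpi2|exact: atan_ltpi2].
have pi0 := @pi_gt0 R.
have -> : atan z / pi + 1 / 2 = (atan z + pi / 2) / pi by field; lra.
by rewrite divr_gt0 ?ltr_pdivrMr//; lra.
Qed.

Lemma pdmf_left p z :
  pdmf p (core p - dl p + dl p * (atan z / pi + 1 / 2)) = gauss_cdf (ml p) z.
Proof.
have /andP[u0 u1] := scaled_atan z; set u := _ + 1 / 2 in u0 u1 *.
have d0 := dl_gt0 p; have r0 := dr_gt0 p.
have lt_core : core p - dl p + dl p * u < core p by nra.
rewrite /pdmf (lt_eqF lt_core) lt_core ifF; last first.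
  by apply/negbTE; rewrite negb_or -!ltNge; apply/andP; split; nra.
congr (gauss_cdf _ _); rewrite -[RHS]atanK; congr (tan _).
rewrite /u; move: (@pi R) (@pi_gt0 R) => w w0.
by field; rewrite !gt_eqF.
Qed.

Lemma pdmf_right p z :
  pdmf p (core p + dr p - dr p * (atan z / pi + 1 / 2)) = gauss_cdf (mr p) z.
Proof.
have /andP[u0 u1] := scaled_atan z; set u := _ + 1 / 2 in u0 u1 *.
have d0 := dl_gt0 p; have r0 := dr_gt0 p.
have gt_core : core p < core p + dr p - dr p * u by nra.
rewrite /pdmf (gt_eqF gt_core) (lt_gtF gt_core) ifF; last first.
  by apply/negbTE; rewrite negb_or -!ltNge; apply/andP; split; nra.
congr (gauss_cdf _ _); rewrite -[RHS]atanK; congr (tan _).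
rewrite /u; move: (@pi R) (@pi_gt0 R) => w w0.
by field; rewrite !gt_eqF.
Qed.

Lemma gpdmf_eqP p q : core p = core q -> dl p = dl q -> dr p = dr q ->
  ml p = ml q -> mr p = mr q -> p = q.
Proof.
case: p q => [x d e m n d0 e0] [x' d' e' m' n' d0' e0'] /=.
move=> ? ? ? ? ?; subst.
by rewrite (bool_irrelevance d0 d0') (bool_irrelevance e0 e0').
Qed.

Lemma pdmf_inj p q : pdmf p =1 pdmf q -> p = q.
Proof.
move=> e.
have ec : core p = core q.
  by apply/eqP; rewrite -pdmf_eq1 -e pdmf_eq1.
have hs tau : (core q - dl p < tau) && (tau < core q + dr p) =
              (core q - dl q < tau) && (tau < core q + dr q).
  by rewrite -{1 2}ec -!pdmf_gt0 e.
have [p1 p2 q1 q2] := And4 (dl_gt0 p) (dr_gt0 p) (dl_gt0 q) (dr_gt0 q).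
have el : dl p = dl q.
  apply/eqP; rewrite eq_le; apply/andP; split; rewrite leNgt; apply/negP => h.
    have := hs (core q - dl q); rewrite ltxx/= => /negP[].
    by apply/andP; split; lra.
  have := hs (core q - dl p); rewrite ltxx/= => /esym/negP[].
  by apply/andP; split; lra.
have er : dr p = dr q.
  apply/eqP; rewrite eq_le; apply/andP; split; rewrite leNgt; apply/negP => h.
    have := hs (core q + dr q); rewrite ltxx andbF => /negP[].
    by apply/andP; split; lra.
  have := hs (core q + dr p); rewrite ltxx andbF => /esym/negP[].
  by apply/andP; split; lra.
apply: gpdmf_eqP => //; apply: gauss_cdf_inj => z.
  by rewrite -!pdmf_left -e ec el.
by rewrite -!pdmf_right -e ec er.
Qed.

End pdmf_theory.

HB.instance Definition _ (R : realType) := gen_eqMixin (gpdmf R).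
HB.instance Definition _ (R : realType) := gen_choiceMixin (gpdmf R).

Section operations.
Context {R : realType}.
Implicit Types (p q r : gpdmf R) (a b : R).

Definition gpdmf_zero : gpdmf R := Gpdmf 0 0 0 ltr01 ltr01.

Definition gpdmf_opp p : gpdmf R :=
  @Gpdmf R (- core p) (dl p)^-1 (dr p)^-1 (- ml p) (- mr p)
    (etrans (invr_gt0 _) (dl_gt0 p)) (etrans (invr_gt0 _) (dr_gt0 p)).

Definition gpdmf_add p q : gpdmf R :=
  Gpdmf (core p + core q) (ml p + ml q) (mr p + mr q)
    (mulr_gt0 (dl_gt0 p) (dl_gt0 q)) (mulr_gt0 (dr_gt0 p) (dr_gt0 q)).

Definition gpdmf_scale a p : gpdmf R :=
  Gpdmf (a * core p) (a * ml p) (a * mr p)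
    (powR_gt0 a (dl_gt0 p)) (powR_gt0 a (dr_gt0 p)).

Definition gpdmf_one : gpdmf R := Gpdmf 1 1 1 (expR_gt0 1) (expR_gt0 1).

Definition gpdmf_mul p q : gpdmf R :=
  Gpdmf (core p * core q) (ml p * ml q) (mr p * mr q)
    (powR_gt0 (ln (dl q)) (dl_gt0 p)) (powR_gt0 (ln (dr q)) (dr_gt0 p)).

Fact gpdmf_addA : associative gpdmf_add.
Proof. by move=> p q r; apply: gpdmf_eqP => /=; ring. Qed.

Fact gpdmf_addC : commutative gpdmf_add.
Proof. by move=> p q; apply: gpdmf_eqP => /=; ring. Qed.

Fact gpdmf_add0 : left_id gpdmf_zero gpdmf_add.
Proof. by move=> p; apply: gpdmf_eqP => /=; ring. Qed.

Fact gpdmf_addN : left_inverse gpdmf_zero gpdmf_opp gpdmf_add.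
Proof.
move=> p; apply: gpdmf_eqP => /=; rewrite ?addNr// mulVf//.
  by rewrite gt_eqF ?dl_gt0.
by rewrite gt_eqF ?dr_gt0.
Qed.

HB.instance Definition _ := GRing.isZmodule.Build (gpdmf R)
  gpdmf_addA gpdmf_addC gpdmf_add0 gpdmf_addN.

Let powR_lnC (x y : R) : 0 < x -> 0 < y -> x `^ ln y = y `^ ln x.
Proof. by move=> x0 y0; rewrite /powR !gt_eqF// mulrC. Qed.

Fact gpdmf_mulA : associative gpdmf_mul.
Proof.
by move=> p q r; apply: gpdmf_eqP => /=;
  rewrite ?ln_powR -?powRrM ?mulrA// mulrC.
Qed.

Fact gpdmf_mulC : commutative gpdmf_mul.
Proof.
by move=> p q; apply: gpdmf_eqP => /=;
  rewrite ?(mulrC (core p)) ?(mulrC (ml p)) ?(mulrC (mr p))// powR_lnC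
    ?dl_gt0 ?dr_gt0.
Qed.

Fact gpdmf_mul1 : left_id gpdmf_one gpdmf_mul.
Proof.
by move=> p; apply: gpdmf_eqP => /=; rewrite ?mul1r//
  powR_lnC ?expR_gt0 ?dl_gt0 ?dr_gt0// expRK powRr1// ltW ?dl_gt0 ?dr_gt0.
Qed.

Fact gpdmf_mulD : left_distributive gpdmf_mul gpdmf_add.
Proof.
by move=> p q r; apply: gpdmf_eqP => /=; rewrite ?mulrDl//
  powRM// ltW ?dl_gt0 ?dr_gt0.
Qed.

Fact gpdmf_one_neq0 : gpdmf_one != 0.
Proof. by apply/eqP => /(congr1 (@core R))/eqP; rewrite oner_eq0. Qed.

HB.instance Definition _ := GRing.Zmodule_isComNzRing.Build (gpdmf R)
  gpdmf_mulA gpdmf_mulC gpdmf_mul1 gpdmf_mulD gpdmf_one_neq0.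

Fact gpdmf_scaleA a b p :
  gpdmf_scale a (gpdmf_scale b p) = gpdmf_scale (a * b) p.
Proof.
by apply: gpdmf_eqP => /=; rewrite ?mulrA// -powRrM mulrC.
Qed.

Fact gpdmf_scale1 : left_id 1 gpdmf_scale.
Proof.
by move=> p; apply: gpdmf_eqP => /=; rewrite ?mul1r// powRr1// ltW
  ?dl_gt0 ?dr_gt0.
Qed.

Fact gpdmf_scaleDr : right_distributive gpdmf_scale +%R.
Proof.
by move=> a p q; apply: gpdmf_eqP => /=; rewrite ?mulrDr//
  powRM// ltW ?dl_gt0 ?dr_gt0.
Qed.

Fact gpdmf_scaleDl p : {morph gpdmf_scale^~ p : a b / a + b}.
Proof.
by move=> a b; apply: gpdmf_eqP => /=; rewrite ?mulrDl// powRD//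
  ?(gt_eqF (dl_gt0 p)) ?(gt_eqF (dr_gt0 p)) implybT.
Qed.

HB.instance Definition _ := GRing.Zmodule_isLmodule.Build R (gpdmf R)
  gpdmf_scaleA gpdmf_scale1 gpdmf_scaleDr gpdmf_scaleDl.

End operations.

Definition gpdmf_diag (R : realType) (a : R) : gpdmf R :=
  Gpdmf a a a (expR_gt0 a) (expR_gt0 a).

Definition gpdmf_V (R : realType) : set (gpdmf R) := range (@gpdmf_diag R).

(* Product of a real matrix with a fuzzy vector; the product of a fuzzy matrix
   with a fuzzy vector is [*m] over the ring [gpdmf R]. *)
Definition crisp_mulmx (R : realType) (m n : nat)
    (A : 'M[R]_(m, n)) (x : 'cV[gpdmf R]_n) : 'cV[gpdmf R]_m :=
  \col_i \sum_(k < n) A i k *: x k 0.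

(* Main.v *)
Require Import Defs.
From mathcomp Require Import all_boot all_order all_algebra.
From mathcomp Require Import all_classical all_reals all_analysis.
Import Order.TTheory GRing.Theory Num.Theory.
Local Open Scope classical_set_scope.
Local Open Scope ring_scope.

(** The set V is the image of the scalars in the ring: ring multiplication by
    [gpdmf_diag a] is scalar multiplication by [a], because
    (e^a)^(ln d) = e^(a ln d) = d^a for both widths [d] ([gpdmf_diag_mul]).
    Hence, with [A] the matrix of the cores of [At], the two systems have
    literally the same left-hand side at every [x] ([mulmx_gpdmf_V]). *)

Lemma gpdmf_diag_mul (R : realType) (a : R) (p : gpdmf R) :
  gpdmf_diag a * p = a *: p.
Proof.
have expR_powR_ln (d : R) : 0 < d -> expR a `^ ln d = d `^ a.
  by move=> d0; rewrite /powR !gt_eqF ?expR_gt0// expRK mulrC.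
by apply: gpdmf_eqP => //=; rewrite expR_powR_ln ?dl_gt0 ?dr_gt0.
Qed.

Lemma gpdmf_V_mul (R : realType) (v p : gpdmf R) :
  gpdmf_V v -> v * p = core v *: p.
Proof. by case=> a _ <-; exact: gpdmf_diag_mul. Qed.

Lemma mulmx_gpdmf_V (R : realType) (m n : nat) (At : 'M[gpdmf R]_(m, n))
    (x : 'cV[gpdmf R]_n) : (forall i j, gpdmf_V (At i j)) ->
  At *m x = crisp_mulmx (map_mx (@core R) At) x.
Proof.
move=> At_V; apply/matrixP => i j; rewrite !mxE (ord1 j).
by apply: eq_bigr => k _; rewrite mxE gpdmf_V_mul.
Qed.

Theorem proposition4p2 (R : realType) (m n : nat) (At : 'M[gpdmf R]_(m, n))
    (At_V : forall i j, gpdmf_V (At i j)) :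
  exists A : 'M[R]_(m, n), forall b : 'cV[gpdmf R]_m,
    [set x : 'cV[gpdmf R]_n | crisp_mulmx A x = b] =
    [set x : 'cV[gpdmf R]_n | At *m x = b].
Proof.
exists (map_mx (@core R) At) => b.
by apply/seteqP; split=> x /=; rewrite mulmx_gpdmf_V.
Qed.
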